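(* Consider a $[pqrs]$ random walk on the finite integer interval $[a,b]$, where $a$ and $b$ are absorbing barriers, started in $i_0$ with $a<i_0<b$. For $a\le n\le b$ the probability of absorption in state $n$ is $s_nx_n$, where $s_a=s_b=1$, $s_n=s$ for $n=a+1,\dots,b-1$, and the expected numbers of visits $x_n$ are $$x_a=\frac{\xi_1^{b-i_0}-\xi_2^{b-i_0}}{\xi_1^{b-a}-\xi_2^{b-a}},\qquad x_b=\frac{\xi_2^{a-i_0}-\xi_1^{a-i_0}}{\xi_2^{a-b}-\xi_1^{a-b}},$$ $$x_n=\begin{cases}\dfrac{\zeta(\xi_2^{b-i_0}-\xi_1^{b-i_0})(\xi_1^a\xi_2^n-\xi_1^n\xi_2^a)}{\xi_1^b\xi_2^a-\xi_1^a\xi_2^b} & (a+1\le n\le i_0),\\[2ex] \dfrac{\zeta(\xi_2^{a-i_0}-\xi_1^{a-i_0})(\xi_1^b\xi_2^n-\xi_1^n\xi_2^b)}{\xi_1^b\xi_2^a-\xi_1^a\xi_2^b} & (i_0\le n\le b-1).\end{cases}$$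
   Context: Let $p,q,s>0$, $r\ge0$ with $p+q+r+s=1$. A $[pqrs]$ random walk on an interval of integers: in each state $n$ that is not an absorbing barrier, at each time unit the walk moves to $n+1$ with probability $p$, moves to $n-1$ with probability $q$, stays in $n$ for a time unit with probability $r$, and with probability $s$ is absorbed in the current state $n$ (the process terminates there). When the walk reaches an absorbing barrier it is absorbed there (the process terminates). $x_n$ denotes the expected number of visits to state $n$ when starting in $i_0$ (time $0$ counted; reaching a barrier counts as one visit). Notation: $$\xi_1=\frac{(1-r)+\sqrt{(1-r)^2-4pq}}{2q},\quad \xi_2=\frac{(1-r)-\sqrt{(1-r)^2-4pq}}{2q},\quad \zeta=\left[(1-r)^2-4pq\right]^{-1/2};$$ one has $\xi_1>1>\xi_2>0$. *)

(* Defs.v *)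
(* MathComp / MathComp-Analysis *)
From HB Require Import structures.
From mathcomp Require Import all_boot all_order all_algebra.
From mathcomp Require Import all_classical all_reals all_analysis.
Set Implicit Arguments.
Unset Strict Implicit.
Unset Printing Implicit Defensive.
Import Order.TTheory GRing.Theory Num.Theory.
Import numFieldNormedType.Exports.
Local Open Scope classical_set_scope.
Local Open Scope ring_scope.

(* [At n]: the process is running and visits n at the current time.
   [Absorbed n]: the process has already terminated, in state n. *)
Variant walk_state := At of int | Absorbed of int.

(* One-step transition probabilities of the walk whose absorbing barriers are
   the integers satisfying [barrier]. Absorption in n takes the visit [At n] to
   [Absorbed n], so it does not add a visit to n; in particular a barrier that
   is reached is visited exactly once. *)
Definition pqrs_step (R : realType) (p q r s : R) (barrier : pred int)
    (x y : walk_state) : R :=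
  match x, y with
  | At n, At m =>
      if barrier n then 0
      else if m == n + 1 then p
      else if m == n - 1 then q
      else if m == n then r
      else 0
  | At n, Absorbed m =>
      if m == n then (if barrier n then 1 else s) else 0
  | Absorbed n, Absorbed m => if m == n then 1 else 0
  | Absorbed _, At _ => 0
  end.

Definition history (T : Type) (X : nat -> T -> walk_state)
    (x : nat -> walk_state) (t : nat) : set T :=
  [set w | forall k, (k <= t)%N -> X k w = x k].

(* [pqrs_walk_markov] is the Markov property with transition probabilities
   [pqrs_step], multiplied out so as not to condition on null events. *)
Record is_pqrs_walk (R : realType) (p q r s : R) (barrier : pred int)
    (i0 : int) (d : measure_display) (T : measurableType d)
    (P : probability T R) (X : nat -> T -> walk_state) : Prop := {
  pqrs_walk_measurable :
    forall t x, measurable [set w | X t w = x];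
  pqrs_walk_start : P [set w | X 0%N w = At i0] = 1%E;
  pqrs_walk_markov : forall (x : nat -> walk_state) (t : nat),
    P (history X x t.+1) =
    (P (history X x t) * (pqrs_step p q r s barrier (x t) (x t.+1))%:E)%E
}.

Definition visits (R : realType) (T : Type) (X : nat -> T -> walk_state)
    (n : int) (w : T) : \bar R :=
  (\sum_(0 <= t <oo) (\1_[set w' | X t w' = At n] w)%:E)%E.

Definition expected_visits (R : realType) (d : measure_display)
    (T : measurableType d) (P : probability T R) (X : nat -> T -> walk_state)
    (n : int) : \bar R :=
  (\int[P]_w visits R X n w)%E.

Definition absorbed_in (T : Type) (X : nat -> T -> walk_state) (n : int) :
    set T :=
  [set w | exists t, X t w = Absorbed n].

(* The barriers of the finite interval [a, b]; started strictly between a and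
   b, the walk almost surely stays in [a, b]. *)
Definition endpoints (a b : int) : pred int := [pred n | (n == a) || (n == b)].

Definition absorption_rate (R : realType) (s : R) (a b n : int) : R :=
  if endpoints a b n then 1 else s.

Definition xi1 (R : realType) (p q r : R) : R :=
  ((1 - r) + Num.sqrt ((1 - r) ^+ 2 - 4 * p * q)) / (2 * q).

Definition xi2 (R : realType) (p q r : R) : R :=
  ((1 - r) - Num.sqrt ((1 - r) ^+ 2 - 4 * p * q)) / (2 * q).

Definition zeta (R : realType) (p q r : R) : R :=
  ((1 - r) ^+ 2 - 4 * p * q) `^ (- (1 / 2)).

(* Main.v *)
Require Import Defs.
From HB Require Import structures.
From mathcomp Require Import all_boot all_order all_algebra.
From mathcomp Require Import all_classical all_reals all_analysis.
From mathcomp Require Import measurable_realfun.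
From mathcomp Require Import ring lra zify.
Import Order.TTheory GRing.Theory Num.Theory.
Import numFieldNormedType.Exports.
Local Open Scope classical_set_scope.
Local Open Scope ring_scope.

(** Write [u t n] for the probability that the walk is alive in [n] at time
    [t]. By Tonelli, the expected number of visits to [n] is the sum over [t]
    of [u t n]; call it [y n].

    Absorption. Between [t] and [t + 1] the mass of [Absorbed n] grows by
    [u t n] times the absorption rate of [n] ([absorbed_step]), and it starts
    from zero, so the mass of [Absorbed n] at time [t] is the rate times a
    partial sum of the series defining [y n]. Since [Absorbed n] is almost
    surely never left, this mass increases to the probability of being
    absorbed in [n] ([absorbed_mass_cvg]). Hence that probability is the rate
    times [y n] ([absorption_visits]). As the rate is positive and a
    probability is at most one, [y n] is finite.

    Visits. Summing the forward equation of the chain over time gives a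
    stationary linear equation for [y] with a unit source in [i0]
    ([visits_equation]). In the interior of the interval it reads
    [(1 - r) y n = (n == i0) + p y (n - 1) + q y (n + 1)], where the
    contributions of the two barriers are to be replaced by zero because a walk
    never leaves a barrier. So, in the interior, [y] solves a Dirichlet
    problem whose characteristic polynomial [q X^2 - (1 - r) X + p] has the
    roots [xi1 > xi2 > 0]. The problem has only one solution
    ([dirichlet_unique]), and the claimed formula is one ([green_equation]).
    At the barriers the same equation degenerates to [y a = q y (a + 1)] and
    [y b = p y (b - 1)], the outside of the interval being never visited.

    The forward equation is not part of the definition of the walk, which
    prescribes the probabilities of entire histories; it is recovered by
    forgetting the past one time at a time ([markov_window]). *)

(** * The Dirichlet problem for a second-order recurrence *)

(** Killing is what separates the roots: since [1 - r = p + q + s], the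
    discriminant equals [(p - q)^2 + s (2 (p + q) + s)], which is positive as
    soon as [s] is. The square root of the discriminant is [q (xi1 - xi2)], so
    [zeta] is the inverse of the latter. *)
Lemma characteristic_roots {R : realType} (p q r s : R) :
  0 < p -> 0 < q -> 0 < s -> p + q + r + s = 1 ->
  [/\ 0 < xi2 p q r < xi1 p q r,
      q * (xi1 p q r + xi2 p q r) = 1 - r,
      q * (xi1 p q r * xi2 p q r) = p &
      zeta p q r = (q * (xi1 p q r - xi2 p q r))^-1].
Proof.
move=> p0 q0 s0 pqrs; rewrite /xi1 /xi2 /zeta.
set D := _ - 4 * p * q; set u := Num.sqrt D; set c := 1 - r.
have cE : c = p + q + s by rewrite /c -pqrs; ring.
have DE : D = (p - q) ^+ 2 + s * (2 * (p + q) + s).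
  by rewrite /D -/c cE; ring.
have D0 : 0 < D.
  by rewrite DE ltr_wpDl ?sqr_ge0// mulr_gt0// !addr_gt0// mulr_gt0// addr_gt0.
have u0 : 0 < u by rewrite sqrtr_gt0.
have u2 : u ^+ 2 = c ^+ 2 - 4 * p * q by rewrite sqr_sqrtr// ltW.
have uc : u < c.
  have c0 : 0 < c by rewrite cE !addr_gt0.
  rewrite -(ltr_pXn2r (n := 2)) ?nnegrE ?(ltW u0) ?(ltW c0)// u2.
  by rewrite gtrBl !mulr_gt0.
have q20 : 0 < 2 * q by rewrite mulr_gt0.
have qn0 : q != 0 by rewrite gt_eqF.
have n20 : (2 : R) != 0 by rewrite gt_eqF.
split.
- by rewrite divr_gt0 ?subr_gt0//= ltr_pM2r ?invr_gt0//; lra.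
- by field.
- have -> : q * ((c + u) / (2 * q) * ((c - u) / (2 * q))) =
            (c ^+ 2 - u ^+ 2) / (4 * q) by field.
  by rewrite u2; field.
- rewrite powRN div1r powR12_sqrt ?(ltW D0)// -/u; congr (_^-1).
  by field.
Qed.

(** A solution vanishing at [0] is a multiple of [x1^k - x2^k], the multiple
    being [d 1 / (x1 - x2)]; if it vanishes at [N] as well, the multiple is
    zero. *)
Lemma recurrence_dirichlet0 {K : fieldType} (p q c x1 x2 : K) (N : nat)
    (d : nat -> K) :
  q != 0 -> q * (x1 + x2) = c -> q * (x1 * x2) = p ->
  x1 ^+ N != x2 ^+ N -> d 0%N = 0 -> d N = 0 ->
  (forall k, (k.+2 <= N)%N -> c * d k.+1 = p * d k + q * d k.+2) ->
  forall k, (k <= N)%N -> d k = 0.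
Proof.
move=> q0 cE pE xN d0 dN rec.
have x12 : x1 - x2 != 0 by rewrite subr_eq0; apply: contraNneq xN => ->.
have solve k : ((k <= N)%N -> (x1 - x2) * d k = d 1%N * (x1 ^+ k - x2 ^+ k)) /\
    ((k.+1 <= N)%N -> (x1 - x2) * d k.+1 = d 1%N * (x1 ^+ k.+1 - x2 ^+ k.+1)).
  elim: k => [|k [IHk IHk1]].
    by rewrite d0; split=> _; [rewrite mulr0 subrr mulr0|rewrite !expr1 mulrC].
  split=> // kN; apply: (mulfI q0).
  rewrite mulrCA (_ : q * d k.+2 = c * d k.+1 - p * d k); last first.
    by rewrite rec// addrAC subrr add0r.
  rewrite mulrBr !(mulrCA (x1 - x2)) IHk1 1?ltnW// IHk; last lia.
  by rewrite -cE -pE !exprS; ring.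
have d1 : d 1%N = 0.
  have /eqP := (solve N).1 (leqnn N).
  by rewrite dN mulr0 eq_sym mulf_eq0 subr_eq0 (negPf xN) orbF => /eqP.
move=> k kN; apply: (mulfI x12).
by rewrite (solve k).1// d1 mul0r mulr0.
Qed.

Lemma exprz_cross_gt0 {K : realFieldType} (x1 x2 : K) (a b : int) :
  0 < x2 < x1 -> a < b -> 0 < x1 ^ b * x2 ^ a - x1 ^ a * x2 ^ b.
Proof.
move=> /andP[x20 x21] ab; have x10 := lt_trans x20 x21.
pose N := `|b - a|%N; have -> : b = a + N%:Z by rewrite /N; lia.
rewrite !expfzDr ?gt_eqF// -!exprnP.
have -> : x1 ^ a * x1 ^+ N * x2 ^ a - x1 ^ a * (x2 ^ a * x2 ^+ N) =
          x1 ^ a * x2 ^ a * (x1 ^+ N - x2 ^+ N) by ring.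
rewrite mulr_gt0 ?mulr_gt0 ?exprz_gt0// subr_gt0.
by rewrite ltr_pXn2r// ?nnegrE ?ltW//; rewrite /N; lia.
Qed.

(** Green function with pole [i0] of the Dirichlet problem on [a, b]. On either
    side of [i0] it is the combination of [x1 ^ n] and [x2 ^ n] that vanishes
    at the nearby end; the two expressions agree in [i0]
    (lemma [green_right]). *)
Definition green {K : realFieldType} (x1 x2 z : K) (a b i0 n : int) : K :=
  if n <= i0 then
    z * (x2 ^ (b - i0) - x1 ^ (b - i0)) * (x1 ^ a * x2 ^ n - x1 ^ n * x2 ^ a) /
    (x1 ^ b * x2 ^ a - x1 ^ a * x2 ^ b)
  else
    z * (x2 ^ (a - i0) - x1 ^ (a - i0)) * (x1 ^ b * x2 ^ n - x1 ^ n * x2 ^ b) /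
    (x1 ^ b * x2 ^ a - x1 ^ a * x2 ^ b).

Lemma green_right {K : realFieldType} (x1 x2 z : K) (a b i0 n : int) :
  x1 != 0 -> x2 != 0 -> i0 <= n ->
  green x1 x2 z a b i0 n =
  z * (x2 ^ (a - i0) - x1 ^ (a - i0)) * (x1 ^ b * x2 ^ n - x1 ^ n * x2 ^ b) /
  (x1 ^ b * x2 ^ a - x1 ^ a * x2 ^ b).
Proof.
move=> x10 x20; rewrite /green le_eqVlt => /predU1P[<-|]; last first.
  by rewrite ltNge => /negPf ->.
rewrite lexx; congr (_ / _); rewrite !expfzDr// -!invr_expz -!mulrA.
congr (_ * _).
by field; rewrite !expfz_neq0.
Qed.

Lemma green_left_end {K : realFieldType} (x1 x2 z : K) (a b i0 : int) :
  a <= i0 -> green x1 x2 z a b i0 a = 0.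
Proof. by move=> ai; rewrite /green ai subrr mulr0 mul0r. Qed.

Lemma green_right_end {K : realFieldType} (x1 x2 z : K) (a b i0 : int) :
  i0 < b -> green x1 x2 z a b i0 b = 0.
Proof. by move=> ib; rewrite /green leNgt ib subrr mulr0 mul0r. Qed.

(** Away from [i0] the equation holds because the powers of [x1] and [x2]
    solve it. In [i0], the two branches differ by a solution vanishing there,
    namely [z (x1^(n - i0) - x2^(n - i0))], and [q z (x1 - x2) = 1] makes the
    jump the unit source. *)
Lemma green_equation {K : realFieldType} (p q c x1 x2 : K) (a b i0 n : int) :
  q != 0 -> 0 < x2 < x1 -> q * (x1 + x2) = c -> q * (x1 * x2) = p -> a < b ->
  let g := green x1 x2 (q * (x1 - x2))^-1 a b i0 in
  c * g n = (n == i0)%:R + p * g (n - 1) + q * g (n + 1).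
Proof.
move=> q0 x21 <- <- ab g; have D0 := exprz_cross_gt0 x1 x2 a b x21 ab.
have x1n : x1 != 0 by move: x21; lra.
have x2n : x2 != 0 by move: x21; lra.
have x12 : x1 - x2 != 0 by move: x21; lra.
have shift (x : K) (m : int) : x != 0 ->
    (x ^ (m + 1) = x ^ m * x) * (x ^ (m - 1) = x ^ m / x).
  by move=> xn; split; rewrite expfzDr ?expr1z ?exprN1.
have [ni|ni] := ltP n i0.
  rewrite /g /green !ifT; [|lia..]; rewrite (_ : n == i0 = false) /=; last lia.
  rewrite !shift//.
  by field; rewrite ?(gt_eqF D0) ?x1n ?x2n ?x12 ?q0.
rewrite le_eqVlt in ni; case/predU1P: ni => [<-|ni]; last first.
  rewrite /g !green_right//; [|lia..].
  rewrite (_ : n == i0 = false) /=; last lia.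
  rewrite !shift//.
  by field; rewrite ?(gt_eqF D0) ?x1n ?x2n ?x12 ?q0.
rewrite eqxx /= /g [in LHS]green_right//.
rewrite [green _ _ _ _ _ _ (_ + 1)]green_right//; last lia.
rewrite /green ifT; last lia.
rewrite !shift// !expfzDr// -!invr_expz.
by field; rewrite ?(gt_eqF D0) ?x1n ?x2n ?x12 ?q0 ?expfz_neq0.
Qed.

(** The source [h] is arbitrary because only the difference of two solutions
    matters. *)
Lemma dirichlet_unique {K : realFieldType} (p q c x1 x2 : K) (a b : int)
    (h f g : int -> K) :
  q != 0 -> 0 < x2 < x1 -> q * (x1 + x2) = c -> q * (x1 * x2) = p -> a < b ->
  f a = g a -> f b = g b ->
  (forall n, a < n < b -> c * f n = h n + p * f (n - 1) + q * f (n + 1)) ->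
  (forall n, a < n < b -> c * g n = h n + p * g (n - 1) + q * g (n + 1)) ->
  forall n, a <= n <= b -> f n = g n.
Proof.
move=> q0 x21 cE pE ab fga fgb fE gE n nab.
pose N := `|b - a|%N; pose d (k : nat) := f (a + k%:Z) - g (a + k%:Z).
suff dk k : (k <= N)%N -> d k = 0.
  apply/eqP; rewrite -subr_eq0; apply/eqP; have := dk `|n - a|%N.
  by rewrite /d (_ : a + `|n - a|%N%:Z = n); [apply; lia|lia].
apply: (recurrence_dirichlet0 p q c x1 x2 N d q0 cE pE).
- case/andP: x21 => x20 x21; rewrite gt_eqF// ltr_pXn2r// ?nnegrE ?ltW//.
    by rewrite /N; lia.
  exact: lt_trans x20 x21.
- by rewrite /d addr0 fga subrr.
- by rewrite /d (_ : a + N%:Z = b) ?fgb ?subrr// /N; lia.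
move=> j jN; have := fE (a + j.+1%:Z); have := gE (a + j.+1%:Z).
have -> : a + j.+1%:Z - 1 = a + j%:Z by lia.
have -> : a + j.+1%:Z + 1 = a + j.+2%:Z by lia.
move=> gj fj; rewrite /d mulrBr gj ?fj; [ring|lia..].
Qed.

(** * Marginals of a countable-state chain *)

Definition sum_of_walk_state (x : walk_state) : int + int :=
  match x with At n => inl n | Absorbed n => inr n end.

Definition walk_state_of_sum (y : int + int) : walk_state :=
  match y with inl n => At n | inr n => Absorbed n end.

Lemma sum_of_walk_stateK : cancel sum_of_walk_state walk_state_of_sum.
Proof. by case. Qed.

HB.instance Definition _ :=
  Countable.copy walk_state (can_type sum_of_walk_stateK).

(** Countable additivity over the level sets of [Y]. With [c = 0] it says that
    a set meeting each level set in a null set is null. *)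
Lemma measure_by_pieces {R : realType} {d} {T : measurableType d}
    (mu : {measure set T -> \bar R}) {U : countType} (Y : T -> U)
    (A B : set T) (c : R) :
  (forall u, measurable [set w | Y w = u]) -> measurable A -> measurable B ->
  (forall u, mu (A `&` [set w | Y w = u]) =
             (c%:E * mu (B `&` [set w | Y w = u]))%E) ->
  mu A = (c%:E * mu B)%E.
Proof.
move=> mY mA mB AB.
(* Countable additivity is about sequences of sets, hence the detour through
   the codes in nat; a number that codes nothing yields the empty set. *)
pose F i := [set w | pickle (Y w) = i].
have F_piece i : F i = set0 \/ exists u, F i = [set w | Y w = u].
  case ui : (@pickle_inv U i) => [u|]; last first.
    left; rewrite -subset0 => w /= wi.
    by move: ui; rewrite -wi pickleK_inv.
  right; exists u; apply/seteqP; split=> w /= wi.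
    by move: ui; rewrite -wi pickleK_inv => -[].
  by have := @pickle_invK U i; rewrite ui /= -wi.
have mF i : measurable (F i) by case: (F_piece i) => [->|[u ->]].
have mass D : measurable D -> mu D = (\sum_(i <oo) mu (D `&` F i))%E.
  move=> mD; have DF : D = \bigcup_i (D `&` F i).
    by apply/seteqP; split=> [w Dw|w [i _ []//]]; exists (pickle (Y w)).
  rewrite {1}DF measure_semi_bigcup//.
  - by move=> i; exact: measurableI.
  - by apply: trivIset_setIl => i j _ _ [w [/= <- <-]].
  - by rewrite -DF.
rewrite mass// [in RHS]mass// -nneseriesZl//.
apply: eq_eseriesr => i _.
by case: (F_piece i) => [->|[u ->]//]; rewrite !setI0 !measure0 mule0.
Qed.

Lemma measure_finite_pieces {R : realType} {d} {T : measurableType d}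
    (mu : {measure set T -> \bar R}) {U : countType} (Y : T -> U)
    (l : seq U) (A : set T) :
  (forall u, measurable [set w | Y w = u]) -> uniq l -> measurable A ->
  (forall u, u \notin l -> mu (A `&` [set w | Y w = u]) = 0%E) ->
  mu A = (\sum_(u <- l) mu (A `&` [set w | Y w = u]))%E.
Proof.
move=> mY; elim: l A => [|u l IHl] A /=.
  move=> _ mA A0; rewrite big_nil (measure_by_pieces mu Y A A 0)// ?mul0e//.
  by move=> v; rewrite mul0e A0.
move=> /andP[ul uniql] mA A0; rewrite big_cons.
have -> : mu A = (mu (A `&` [set w | Y w = u]) +
                  mu (A `\` [set w | Y w = u]))%E.
  by rewrite addeC; exact: measureDI.
congr (_ + _)%E.
have piece v : v != u ->
    (A `\` [set w | Y w = u]) `&` [set w | Y w = v] = A `&` [set w | Y w = v].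
  move=> /eqP vu; apply/seteqP; split=> w /= [].
    by move=> [? ?].
  by move=> ? wv; do !split => //; rewrite wv.
rewrite IHl//; last first.
- move=> v vl; have [->|vu] := eqVneq v u.
    by rewrite setDE -setIA setICl setI0 measure0.
  by rewrite piece// A0// inE negb_or vu.
- exact: measurableD.
rewrite big_seq [RHS]big_seq; apply: eq_bigr => v vl; rewrite piece//.
by apply: contraNneq ul => <-.
Qed.

(** Histories that start at a time [j] other than zero. *)
Definition window {T : Type} (X : nat -> T -> walk_state)
    (x : nat -> walk_state) (j t : nat) : set T :=
  [set w | forall k, (j <= k <= t)%N -> X k w = x k].

Lemma measurable_window {d} {T : measurableType d} (X : nat -> T -> walk_state)
    (x : nat -> walk_state) (j t : nat) :
  (forall t x, measurable [set w | X t w = x]) -> measurable (window X x j t).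
Proof.
move=> mX.
have -> : window X x j t =
    \bigcap_(k in [set k | (j <= k <= t)%N]) [set w | X k w = x k] by [].
by apply: bigcap_measurableType => k _; exact: mX.
Qed.

(** The Markov property for histories with a forgotten past, by induction on
    the time [j] where they start: the window from [j + 1] is the countable
    disjoint union, over the states [y] at time [j], of windows from [j], and
    the transition factor is common to all of them because the state at time
    [t] is left untouched. *)
Lemma markov_window {R : realType} {p q r s : R} {barrier : pred int}
    {i0 : int} {d} {T : measurableType d} {P : probability T R}
    {X : nat -> T -> walk_state} (j t : nat) (x : nat -> walk_state) :
  is_pqrs_walk p q r s barrier i0 P X -> (j <= t)%N ->
  P (window X x j t.+1) =
  ((pqrs_step p q r s barrier (x t) (x t.+1))%:E * P (window X x j t))%E.
Proof.
move=> hX; have mX := pqrs_walk_measurable hX.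
elim: j x => [|j IHj] x jt.
  rewrite muleC -(pqrs_walk_markov hX x t).
  by congr (P _).
apply: (measure_by_pieces P (X j)) => //; [exact: measurable_window..|].
move=> y; pose x' k := if k == j then y else x k.
have prefix t' : (j <= t')%N ->
    window X x j.+1 t' `&` [set w | X j w = y] = window X x' j t'.
  move=> jt'; apply/seteqP; split=> w /=.
    move=> [xw jy] k kP; rewrite /x'; case: eqVneq => [->//|kj].
    by apply: xw; lia.
  move=> xw; split=> [k kP|].
    by have := xw k; rewrite /x' ifN; [apply; lia|lia].
  by have := xw j; rewrite /x' eqxx; apply; lia.
rewrite !prefix; [|lia..]; have := IHj x' (ltnW jt).
by rewrite /x' !ifN //; lia.
Qed.

Lemma markov_pair {R : realType} {p q r s : R} {barrier : pred int}
    {i0 : int} {d} {T : measurableType d} {P : probability T R}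
    {X : nat -> T -> walk_state} (t : nat) (x y : walk_state) :
  is_pqrs_walk p q r s barrier i0 P X ->
  P ([set w | X t.+1 w = y] `&` [set w | X t w = x]) =
  ((pqrs_step p q r s barrier x y)%:E * P [set w | X t w = x])%E.
Proof.
move=> hX; pose z k := if (k <= t)%N then x else y.
have := markov_window t t z hX (leqnn t).
rewrite /z leqnn ltnn => h.
transitivity (P (window X z t t.+1)).
  congr (P _); apply/seteqP; split=> w /=.
    move=> [wy wx] k kP; rewrite /z; case: leqP => kt.
      by have -> : k = t by lia.
    by have -> : k = t.+1 by lia.
  move=> H; split.
    by have := H t.+1; rewrite /z ltnn; apply; lia.
  by have := H t; rewrite /z leqnn; apply; lia.
rewrite h; congr (_ * P _)%E; apply/seteqP; split=> w /= H.
  by have := H t; rewrite /z leqnn; apply; lia.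
move=> k kP; have -> : k = t by lia.
by rewrite leqnn.
Qed.

(** The sum is over a list [l] containing all possible predecessors of [y]. *)
Lemma forward_equation {R : realType} {p q r s : R} {barrier : pred int}
    {i0 : int} {d} {T : measurableType d} {P : probability T R}
    {X : nat -> T -> walk_state} (t : nat) (y : walk_state)
    (l : seq walk_state) :
  is_pqrs_walk p q r s barrier i0 P X -> uniq l ->
  (forall x, x \notin l -> pqrs_step p q r s barrier x y = 0) ->
  P [set w | X t.+1 w = y] =
  (\sum_(x <- l) ((pqrs_step p q r s barrier x y)%:E *
                  P [set w | X t w = x]))%E.
Proof.
move=> hX ul l0; have mX := pqrs_walk_measurable hX.
rewrite (measure_finite_pieces P (X t) l)//.
  by apply: eq_bigr => x _; exact: markov_pair hX.
by move=> x xl; have := markov_pair t x y hX; rewrite l0// mul0e.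
Qed.

(** * Absorption probabilities and expected visits *)

Lemma start_mass {R : realType} {p q r s : R} {barrier : pred int}
    {i0 : int} {d} {T : measurableType d} {P : probability T R}
    {X : nat -> T -> walk_state} (x : walk_state) :
  is_pqrs_walk p q r s barrier i0 P X ->
  P [set w | X 0%N w = x] = ((x == At i0)%:R%:E : \bar R).
Proof.
move=> hX; have mX := pqrs_walk_measurable hX.
have [->|xi0] := eqVneq; first exact: pqrs_walk_start hX.
have := probability_setC P (mX 0%N (At i0)).
rewrite (pqrs_walk_start hX) subee// => null.
apply: (subset_measure0 _ _ _ null) => //; first exact: measurableC.
by move=> w /= -> ?; move/eqP: xi0.
Qed.

Lemma alive_step {R : realType} {p q r s : R} {barrier : pred int}
    {i0 : int} {d} {T : measurableType d} {P : probability T R}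
    {X : nat -> T -> walk_state} (t : nat) (n : int) :
  is_pqrs_walk p q r s barrier i0 P X ->
  P [set w | X t.+1 w = At n] =
  ((if barrier (n - 1)%R then 0 else p)%:E * P [set w | X t w = At (n - 1)%R] +
   ((if barrier (n + 1)%R then 0 else q)%:E * P [set w | X t w = At (n + 1)%R] +
    (if barrier n then 0 else r)%:E * P [set w | X t w = At n]))%E.
Proof.
move=> hX.
rewrite (forward_equation t (At n) [:: At (n - 1); At (n + 1); At n] hX).
- rewrite !big_cons big_nil adde0 /=.
  rewrite subrK eqxx addrK eqxx (_ : (n == n + 1 + 1) = false); last lia.
  rewrite (_ : (n == n + 1) = false); last lia.
  by rewrite (_ : (n == n - 1) = false); last lia.
- rewrite /= !inE /= andbT negb_or -andbA; apply/and3P.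
  by split; apply/eqP => -[]; lia.
case=> [m|m]; last by [].
rewrite !inE !negb_or => /and3P[/eqP m1 /eqP m2 /eqP m3] /=.
case: ifP => // _.
rewrite ifN; last by apply/eqP => nm; apply: m1; congr At; lia.
rewrite ifN; last by apply/eqP => nm; apply: m2; congr At; lia.
by rewrite ifN//; apply/eqP => nm; apply: m3; congr At; lia.
Qed.

Lemma absorbed_step {R : realType} {p q r s : R} {barrier : pred int}
    {i0 : int} {d} {T : measurableType d} {P : probability T R}
    {X : nat -> T -> walk_state} (t : nat) (n : int) :
  is_pqrs_walk p q r s barrier i0 P X ->
  P [set w | X t.+1 w = Absorbed n] =
  (P [set w | X t w = Absorbed n] +
   (if barrier n then 1 else s)%:E * P [set w | X t w = At n])%E.
Proof.
move=> hX.
rewrite (forward_equation t (Absorbed n) [:: Absorbed n; At n] hX)//.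
  by rewrite !big_cons big_nil adde0 /= eqxx mul1e.
case=> m; rewrite !inE !negb_or => /andP[/eqP m1 /eqP m2] /=.
  by rewrite ifN//; apply/eqP => nm; apply: m2; congr At.
by rewrite ifN//; apply/eqP => nm; apply: m1; congr Absorbed.
Qed.

Lemma absorbed_mass {R : realType} {p q r s : R} {barrier : pred int}
    {i0 : int} {d} {T : measurableType d} {P : probability T R}
    {X : nat -> T -> walk_state} (t : nat) (n : int) :
  is_pqrs_walk p q r s barrier i0 P X ->
  P [set w | X t w = Absorbed n] =
  (\sum_(0 <= k < t) ((if barrier n then 1 else s)%:E *
                      P [set w | X k w = At n]))%E.
Proof.
move=> hX; elim: t => [|t IHt].
  by rewrite big_geq// (start_mass _ hX).
by rewrite (absorbed_step _ _ hX) IHt big_nat_recr.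
Qed.

Lemma expected_visitsE {R : realType} {d} {T : measurableType d}
    (P : probability T R) (X : nat -> T -> walk_state) (n : int) :
  (forall t x, measurable [set w | X t w = x]) ->
  expected_visits P X n = (\sum_(t <oo) P [set w | X t w = At n])%E.
Proof.
move=> mX; rewrite /expected_visits /visits integral_nneseries//.
  by apply: eq_eseriesr => t _; rewrite integral_indic// setIT.
by move=> t; apply/measurable_EFinP; exact: measurable_indic.
Qed.

Lemma measurable_absorbed_in {d} {T : measurableType d}
    (X : nat -> T -> walk_state) (n : int) :
  (forall t x, measurable [set w | X t w = x]) ->
  measurable (absorbed_in X n).
Proof.
move=> mX.
have -> : absorbed_in X n = \bigcup_t [set w | X t w = Absorbed n].
  by apply/seteqP; split=> w /=; [case=> t ?; exists t|case=> t _ ?; exists t].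
exact: bigcupT_measurable.
Qed.

(** The events [X t = Absorbed n] increase with [t] only up to the null event
    [N] that the walk leaves [Absorbed n] at some time; adding [N] to all of
    them gives an increasing sequence, to which continuity from below
    applies. *)
Lemma absorbed_mass_cvg {R : realType} {p q r s : R} {barrier : pred int}
    {i0 : int} {d} {T : measurableType d} {P : probability T R}
    {X : nat -> T -> walk_state} (n : int) :
  is_pqrs_walk p q r s barrier i0 P X ->
  (fun t => P [set w | X t w = Absorbed n]) @ \oo --> P (absorbed_in X n).
Proof.
move=> hX; have mX := pqrs_walk_measurable hX.
pose leave k :=
  [set w | X k w = Absorbed n] `\` [set w | X k.+1 w = Absorbed n].
have mleave k : measurable (leave k) by exact: measurableD.
have leave0 k : P (leave k) = 0%E.
  rewrite measureD//; last by rewrite ltey_eq fin_num_measure.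
  have := markov_pair k (Absorbed n) (Absorbed n) hX.
  rewrite setIC /= eqxx mul1e => ->.
  by apply: subee; exact: fin_num_measure.
pose N := \bigcup_k leave k.
have mN : measurable N by exact: bigcupT_measurable.
have N0 : P N = 0%E.
  apply/(measure_negligible mN)/negligible_bigcup => k.
  by exists (leave k); split=> //; exact: leave0.
have mabs := measurable_absorbed_in X n mX.
pose B t := [set w | X t w = Absorbed n] `|` N.
have UB : \bigcup_t B t = absorbed_in X n `|` N.
  apply/seteqP; split=> w /=.
    by move=> [t _ [?|?]]; [left; exists t|right].
  by move=> [[t ?]|Nw]; [exists t => //; left|exists 0%N => //; right].
have PB t : P (B t) = P [set w | X t w = Absorbed n] by rewrite measureU0.
rewrite -(measureU0 mabs mN N0) -UB; under eq_fun do rewrite -PB.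
apply: nondecreasing_cvg_mu.
- by move=> t; exact: measurableU.
- by rewrite UB; exact: measurableU.
apply/nondecreasing_seqP => t; apply/subsetPset => w [tw|]; last by right.
have [?|tw'] := pselect (X t.+1 w = Absorbed n); first by left.
by right; exists t.
Qed.

Lemma absorption_visits {R : realType} {p q r s : R} {barrier : pred int}
    {i0 : int} {d} {T : measurableType d} {P : probability T R}
    {X : nat -> T -> walk_state} (n : int) :
  is_pqrs_walk p q r s barrier i0 P X ->
  P (absorbed_in X n) =
  ((if barrier n then 1 else s)%:E * expected_visits P X n)%E.
Proof.
move=> hX; have mX := pqrs_walk_measurable hX.
rewrite expected_visitsE// -nneseriesZl//.
apply/esym/cvg_lim => //.
have := absorbed_mass_cvg n hX.
by under eq_fun do rewrite (absorbed_mass _ _ hX).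
Qed.

(** The rate of absorption in [n] is positive, and its product with the
    expected number of visits is a probability. *)
Lemma expected_visits_fin_num {R : realType} {p q r s : R}
    {barrier : pred int} {i0 : int} {d} {T : measurableType d}
    {P : probability T R} {X : nat -> T -> walk_state} (n : int) :
  0 < s -> is_pqrs_walk p q r s barrier i0 P X ->
  expected_visits P X n \is a fin_num.
Proof.
move=> s0 hX; have := absorption_visits n hX.
have : P (absorbed_in X n) \is a fin_num.
  apply: fin_num_measure; apply: measurable_absorbed_in.
  exact: pqrs_walk_measurable hX.
move=> + E; rewrite E; set c := (if _ then _ else _).
have c0 : 0 < c by rewrite /c; case: ifP.
have : (0 <= expected_visits P X n)%E.
  rewrite expected_visitsE; last exact: pqrs_walk_measurable hX.
  exact: nneseries_ge0.
by case: (expected_visits P X n) => // _; rewrite gt0_muley ?lte_fin.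
Qed.

(** The forward equation summed over all times, the time zero contributing the
    source. *)
Lemma visits_equation {R : realType} {p q r s : R} {barrier : pred int}
    {i0 : int} {d} {T : measurableType d} {P : probability T R}
    {X : nat -> T -> walk_state} (n : int) :
  0 < p -> 0 < q -> 0 <= r -> 0 < s ->
  is_pqrs_walk p q r s barrier i0 P X ->
  let y n := fine (expected_visits P X n) in
  y n = (n == i0)%:R + (if barrier (n - 1) then 0 else p) * y (n - 1) +
        (if barrier (n + 1) then 0 else q) * y (n + 1) +
        (if barrier n then 0 else r) * y n.
Proof.
move=> p0 q0 r0 s0 hX y; have mX := pqrs_walk_measurable hX.
have yE m : expected_visits P X m = (y m)%:E.
  by rewrite fineK//; exact: expected_visits_fin_num s0 hX.
apply: EFin_inj; rewrite !EFinD !EFinM -!yE.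
rewrite !expected_visitsE// [LHS]nneseries_recl//.
rewrite -nneseries_addn// (start_mass _ hX) -!addeA; congr (_ + _)%E.
under [LHS]eq_eseriesr => t _ do rewrite addn1 (alive_step _ _ hX).
have pos c m t : 0 <= c -> (0 <= c%:E * P [set w | X t w = At m])%E.
  by move=> c0; rewrite mule_ge0 ?lee_fin.
rewrite nneseriesD; [|move=> t _ _..]; last 2 first.
- by apply: pos; case: ifP => // _; exact: ltW.
- by rewrite adde_ge0// pos//; case: ifP => // _; exact: ltW.
rewrite nneseriesD; [|move=> t _ _..]; last 2 first.
- by apply: pos; case: ifP => // _; exact: ltW.
- by apply: pos; case: ifP.
by rewrite !nneseriesZl.
Qed.

(** Leaving [a, b] in unit steps requires to step out of [a] or [b], which are
    barriers. *)
Lemma alive_in_interval {R : realType} {p q r s : R} {a b i0 : int}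
    {d} {T : measurableType d} {P : probability T R}
    {X : nat -> T -> walk_state} (t : nat) (n : int) :
  is_pqrs_walk p q r s (endpoints a b) i0 P X -> a < i0 -> i0 < b ->
  ~~ (a <= n <= b) -> P [set w | X t w = At n] = 0%E.
Proof.
move=> hX ai ib; elim: t n => [|t IHt] n nab.
  rewrite (start_mass _ hX); case: eqP => // -[ni]; lia.
have out m k : (n == m + 1) || (n == m - 1) || (n == m) ->
  ((if endpoints a b m then 0 else k)%:E * P [set w | X t w = At m] = 0)%E.
  move=> nm; rewrite /endpoints /=; case: ifPn => mab; first by rewrite mul0e.
  by rewrite IHt ?mule0//; lia.
by rewrite (alive_step _ _ hX) !out ?adde0//; lia.
Qed.

(** * Identification of the expected visits *)

(** Next to a barrier the Green function is proportional to [x1 - x2], which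
    cancels against the normalisation. *)
Lemma green_exit_left {K : realFieldType} (q x1 x2 : K) (a b i0 : int) :
  q != 0 -> 0 < x2 < x1 -> a < i0 -> i0 < b ->
  q * green x1 x2 (q * (x1 - x2))^-1 a b i0 (a + 1) =
  (x1 ^ (b - i0) - x2 ^ (b - i0)) / (x1 ^ (b - a) - x2 ^ (b - a)).
Proof.
move=> q0 x21 ai ib; have D0 := exprz_cross_gt0 x1 x2 a b x21 (lt_trans ai ib).
have x1n : x1 != 0 by move: x21; lra.
have x2n : x2 != 0 by move: x21; lra.
have x12 : x1 - x2 != 0 by move: x21; lra.
have E : x1 ^ (b - a) - x2 ^ (b - a) =
    (x1 ^ b * x2 ^ a - x1 ^ a * x2 ^ b) / (x1 ^ a * x2 ^ a).
  rewrite !expfzDr// -!invr_expz; field.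
  by rewrite !expfz_neq0.
rewrite E /green ifT; last lia.
rewrite !(expfzDr a 1)// !expr1z.
by field; rewrite ?(gt_eqF D0) ?x12 ?q0 ?expfz_neq0.
Qed.

(** Here the factor is [1 / x2 - 1 / x1 = q (x1 - x2) / p]. *)
Lemma green_exit_right {K : realFieldType} (p q x1 x2 : K) (a b i0 : int) :
  q != 0 -> 0 < x2 < x1 -> q * (x1 * x2) = p -> a < i0 -> i0 < b ->
  p * green x1 x2 (q * (x1 - x2))^-1 a b i0 (b - 1) =
  (x2 ^ (a - i0) - x1 ^ (a - i0)) / (x2 ^ (a - b) - x1 ^ (a - b)).
Proof.
move=> q0 x21 <- ai ib.
have D0 := exprz_cross_gt0 x1 x2 a b x21 (lt_trans ai ib).
have x1n : x1 != 0 by move: x21; lra.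
have x2n : x2 != 0 by move: x21; lra.
have x12 : x1 - x2 != 0 by move: x21; lra.
have E : x2 ^ (a - b) - x1 ^ (a - b) =
    (x1 ^ b * x2 ^ a - x1 ^ a * x2 ^ b) / (x1 ^ b * x2 ^ b).
  rewrite !expfzDr// -!invr_expz; field.
  by rewrite !expfz_neq0.
rewrite E green_right//; last lia.
rewrite !(expfzDr b (-1))// !exprN1.
by field; rewrite ?(gt_eqF D0) ?x1n ?x2n ?x12 ?q0 ?expfz_neq0.
Qed.

Lemma expected_visits_outside {R : realType} {p q r s : R} {a b i0 : int}
    {d} {T : measurableType d} {P : probability T R}
    {X : nat -> T -> walk_state} (n : int) :
  is_pqrs_walk p q r s (endpoints a b) i0 P X -> a < i0 -> i0 < b ->
  ~~ (a <= n <= b) -> expected_visits P X n = 0%E.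
Proof.
move=> hX ai ib nab; rewrite expected_visitsE.
  by rewrite eseries0// => t _ _; exact: alive_in_interval hX ai ib nab.
exact: pqrs_walk_measurable hX.
Qed.

Lemma expected_visits_green {R : realType} {p q r s : R} {a b i0 : int}
    {d} {T : measurableType d} {P : probability T R}
    {X : nat -> T -> walk_state} (n : int) :
  0 < p -> 0 < q -> 0 <= r -> 0 < s -> p + q + r + s = 1 ->
  is_pqrs_walk p q r s (endpoints a b) i0 P X -> a < i0 -> i0 < b ->
  a < n < b ->
  fine (expected_visits P X n) =
  green (xi1 p q r) (xi2 p q r) (zeta p q r) a b i0 n.
Proof.
move=> p0 q0 r0 s0 pqrs hX ai ib nab; have ab := lt_trans ai ib.
have [x21 xD xM zE] := characteristic_roots p q r s p0 q0 s0 pqrs.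
have qn0 : q != 0 by rewrite gt_eqF.
pose y (m : int) := fine (expected_visits P X m).
(* A barrier is visited, but feeds nothing back into the interior: the
   Dirichlet problem is solved by the visits with those to the barriers set to
   zero. *)
pose f m := if endpoints a b m then 0 else y m.
transitivity (f n).
  by rewrite /f /endpoints ifN//=; lia.
rewrite zE.
apply: (dirichlet_unique p q (1 - r) (xi1 p q r) (xi2 p q r) a b
  (fun m => (m == i0)%:R)) => //.
- by rewrite /f /endpoints /= eqxx green_left_end// ltW.
- by rewrite /f /endpoints /= eqxx orbT green_right_end.
- move=> m mab; have mE : y m = _ := visits_equation m p0 q0 r0 s0 hX.
  have em : endpoints a b m = false by rewrite /endpoints /=; lia.
  rewrite mulrBl mul1r /f em; rewrite em in mE; rewrite {1}mE addrK.
  by do 2 case: ifP => _; rewrite ?mul0r ?mulr0.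
- by move=> m _; apply: green_equation.
- by case/andP: nab => /ltW -> /ltW ->.
Qed.

Lemma expected_visits_left_end {R : realType} {p q r s : R} {a b i0 : int}
    {d} {T : measurableType d} {P : probability T R}
    {X : nat -> T -> walk_state} :
  0 < p -> 0 < q -> 0 <= r -> 0 < s ->
  is_pqrs_walk p q r s (endpoints a b) i0 P X -> a < i0 -> i0 < b ->
  fine (expected_visits P X a) = q * fine (expected_visits P X (a + 1)).
Proof.
move=> p0 q0 r0 s0 hX ai ib; rewrite (visits_equation a p0 q0 r0 s0 hX).
rewrite (expected_visits_outside (a - 1) hX ai ib); last lia.
rewrite (_ : (a == i0) = false); last lia.
rewrite (_ : endpoints a b (a + 1) = false); last by rewrite /endpoints /=; lia.
by rewrite {2}/endpoints /= eqxx /= mulr0 mul0r !add0r addr0.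
Qed.

Lemma expected_visits_right_end {R : realType} {p q r s : R} {a b i0 : int}
    {d} {T : measurableType d} {P : probability T R}
    {X : nat -> T -> walk_state} :
  0 < p -> 0 < q -> 0 <= r -> 0 < s ->
  is_pqrs_walk p q r s (endpoints a b) i0 P X -> a < i0 -> i0 < b ->
  fine (expected_visits P X b) = p * fine (expected_visits P X (b - 1)).
Proof.
move=> p0 q0 r0 s0 hX ai ib; rewrite (visits_equation b p0 q0 r0 s0 hX).
rewrite (expected_visits_outside (b + 1) hX ai ib); last lia.
rewrite (_ : (b == i0) = false); last lia.
rewrite (_ : endpoints a b (b - 1) = false); last by rewrite /endpoints /=; lia.
by rewrite {2}/endpoints /= eqxx orbT /= mulr0 mul0r !add0r !addr0.
Qed.

Theorem theorem2 (R : realType) (p q r s : R)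
  (hp : 0 < p) (hq : 0 < q) (hs : 0 < s) (hr : 0 <= r)
  (hpqrs : p + q + r + s = 1)
  (a b i0 : int) (hai0 : a < i0) (hi0b : i0 < b)
  (d : measure_display) (T : measurableType d) (P : probability T R)
  (X : nat -> T -> walk_state)
  (hX : is_pqrs_walk p q r s (endpoints a b) i0 P X) :
  let xi1 := xi1 p q r in
  let xi2 := xi2 p q r in
  let zeta := zeta p q r in
  let x := expected_visits P X in
  [/\ forall n : int, a <= n <= b ->
        P (absorbed_in X n) = ((absorption_rate s a b n)%:E * x n)%E,
      x a = ((xi1 ^ (b - i0) - xi2 ^ (b - i0)) /
             (xi1 ^ (b - a) - xi2 ^ (b - a)))%:E,
      x b = ((xi2 ^ (a - i0) - xi1 ^ (a - i0)) /
             (xi2 ^ (a - b) - xi1 ^ (a - b)))%:E,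
      forall n : int, a + 1 <= n <= i0 ->
        x n = (zeta * (xi2 ^ (b - i0) - xi1 ^ (b - i0)) *
                 (xi1 ^ a * xi2 ^ n - xi1 ^ n * xi2 ^ a) /
               (xi1 ^ b * xi2 ^ a - xi1 ^ a * xi2 ^ b))%:E
    & forall n : int, i0 <= n <= b - 1 ->
        x n = (zeta * (xi2 ^ (a - i0) - xi1 ^ (a - i0)) *
                 (xi1 ^ b * xi2 ^ n - xi1 ^ n * xi2 ^ b) /
               (xi1 ^ b * xi2 ^ a - xi1 ^ a * xi2 ^ b))%:E].
Proof.
move=> xi1 xi2 zeta x.
have [x21 xD xM zE] := characteristic_roots p q r s hp hq hs hpqrs.
have qn0 : q != 0 by rewrite gt_eqF.
have xE n : x n = (fine (x n))%:E.
  by rewrite fineK//; exact: expected_visits_fin_num hs hX.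
have xg n : a < n < b -> fine (x n) = green xi1 xi2 zeta a b i0 n.
  exact: expected_visits_green hX hai0 hi0b.
split.
- by move=> n _; exact: absorption_visits hX.
- rewrite xE (expected_visits_left_end hp hq hr hs hX hai0 hi0b) xg; last lia.
  by rewrite /zeta zE green_exit_left.
- rewrite xE (expected_visits_right_end hp hq hr hs hX hai0 hi0b) xg; last lia.
  by rewrite /zeta zE green_exit_right.
- by move=> n nai; rewrite xE xg ?/green ?ifT//; lia.
- move=> n nib; rewrite xE xg ?green_right//; try lia.
    by move: x21; rewrite -/xi1 -/xi2; lra.
  by move: x21; rewrite -/xi1 -/xi2; lra.
Qed.
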